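(* Let $X$ be any topological space. (1) The following are equivalent: (a) $X$ is $SS$; (b) $X$ is separable and $CDFT$; (c) $X$ has a countable dense subset $D$ such that $CDFT_x$ holds for all $x\in D$. (2) The following are equivalent: (a) $X$ is $SS^+$; (b) $X$ is separable and $CDFT^+$; (c) $X$ has a countable dense subset $D$ such that $CDFT_x^+$ holds for all $x\in D$. (3) The following are equivalent: (a) $X$ is $SS^{+mark}$; (b) $X$ is separable and $CDFT^{+mark}$; (c) $X$ has a countable dense subset $D$ such that $CDFT_x^{+mark}$ holds for all $x\in D$.
   Context: $[S]^{<\omega}$ is the set of finite subsets of $S$. For families of sets $\mathcal A,\mathcal B$, the selection principle $S_{fin}(\mathcal A,\mathcal B)$ states: whenever $A_n\in\mathcal A$ for $n<\omega$, there exist $B_n\in[A_n]^{<\omega}$ with $\bigcup_{n<\omega}B_n\in\mathcal B$. In the game $G_{fin}(\mathcal A,\mathcal B)$, in each round $n<\omega$ Player I chooses $A_n\in\mathcal A$ and then Player II chooses $B_n\in[A_n]^{<\omega}$; II wins iff $\bigcup_{n<\omega}B_n\in\mathcal B$. A strategy for II is a function $\sigma$ with $\sigma(\langle A_0,\dots,A_n\rangle)\in[A_n]^{<\omega}$ for all $\langle A_0,\dots,A_n\rangle\in\mathcal A^{n+1}$, $n<\omega$; it is winning if $\bigcup_{n<\omega}\sigma(\langle A_0,\dots,A_n\rangle)\in\mathcal B$ for every sequence $\langle A_0,A_1,\dots\rangle\in\mathcal A^\omega$. A Markov strategy for II is a function $\sigma$ with $\sigma(A,n)\in[A]^{<\omega}$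 for $A\in\mathcal A$, $n<\omega$; it is winning if $\bigcup_{n<\omega}\sigma(A_n,n)\in\mathcal B$ for every $\langle A_0,A_1,\dots\rangle\in\mathcal A^\omega$. If a property $P$ is defined by $S_{fin}(\mathcal A,\mathcal B)$, then $P^+$ means II has a winning strategy in $G_{fin}(\mathcal A,\mathcal B)$, and $P^{+mark}$ means II has a winning Markov strategy. For a space $X$ and $x\in X$: $\mathcal D_X$ is the collection of dense subsets of $X$; $\mathcal B_{X,x}$ is the collection of $A\subseteq X$ with $x\in\overline{A}$. $SS$ (selective separability) is $S_{fin}(\mathcal D_X,\mathcal D_X)$. $CDFT_x$ (countable dense fan tightness at $x$) is $S_{fin}(\mathcal D_X,\mathcal B_{X,x})$. $X$ is $CDFT$ (resp. $CDFT^+$, $CDFT^{+mark}$) if $CDFT_x$ (resp. $CDFT_x^+$, $CDFT_x^{+mark}$) holds for every $x\in X$. *)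

(* Defs.v *)
From mathcomp Require Import all_boot.
From mathcomp Require Import all_classical topology.

Set Implicit Arguments.
Unset Strict Implicit.
Unset Printing Implicit Defensive.

Local Open Scope classical_set_scope.

Section Selection.
Context {T : Type}.
Implicit Types (S : set T) (A B : set (set T)).

(* [S]^{<omega} *)
Definition fin_subsets S : set (set T) :=
  [set F | F `<=` S /\ finite_set F].

Definition Sfin A B : Prop :=
  forall a : nat -> set T, (forall n, A (a n)) ->
  exists b : nat -> set T,
    (forall n, fin_subsets (a n) (b n)) /\ B (\bigcup_n b n).

(* A strategy for II is a total function on finite sequences of sets, of which
   only the values at nonempty sequences of members of A are constrained (and
   used); rcons s a is the history <A_0, ..., A_n> whose last entry A_n is a. *)
Definition is_strategy A (sigma : seq (set T) -> set T) : Prop :=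
  forall (s : seq (set T)) (a : set T),
    (forall c, c \in s -> A c) -> A a ->
    fin_subsets a (sigma (rcons s a)).

(* mkseq a n.+1 is the history <a 0, ..., a n>. *)
Definition winning A B (sigma : seq (set T) -> set T) : Prop :=
  forall a : nat -> set T, (forall n, A (a n)) ->
    B (\bigcup_n sigma (mkseq a n.+1)).

Definition Sfin_plus A B : Prop :=
  exists sigma, is_strategy A sigma /\ winning A B sigma.

Definition is_Markov_strategy A (sigma : set T -> nat -> set T) : Prop :=
  forall (a : set T) (n : nat), A a -> fin_subsets a (sigma a n).

Definition Markov_winning A B (sigma : set T -> nat -> set T) : Prop :=
  forall a : nat -> set T, (forall n, A (a n)) ->
    B (\bigcup_n sigma (a n) n).

Definition Sfin_mark A B : Prop :=
  exists sigma, is_Markov_strategy A sigma /\ Markov_winning A B sigma.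

End Selection.

Definition dense_sets (X : topologicalType) : set (set X) :=
  [set A | dense A].
Arguments dense_sets X : clear implicits.

Definition clustering_sets (X : topologicalType) (x : X) : set (set X) :=
  [set A | closure A x].

Definition separable (X : topologicalType) : Prop :=
  exists D : set X, countable D /\ dense D.

Definition SS (X : topologicalType) : Prop :=
  Sfin (dense_sets X) (dense_sets X).
Definition SS_plus (X : topologicalType) : Prop :=
  Sfin_plus (dense_sets X) (dense_sets X).
Definition SS_mark (X : topologicalType) : Prop :=
  Sfin_mark (dense_sets X) (dense_sets X).

Definition CDFT_at (X : topologicalType) (x : X) : Prop :=
  Sfin (dense_sets X) (clustering_sets x).
Definition CDFT_plus_at (X : topologicalType) (x : X) : Prop :=
  Sfin_plus (dense_sets X) (clustering_sets x).
Definition CDFT_mark_at (X : topologicalType) (x : X) : Prop :=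
  Sfin_mark (dense_sets X) (clustering_sets x).

Definition CDFT (X : topologicalType) : Prop := forall x : X, CDFT_at x.
Definition CDFT_plus (X : topologicalType) : Prop :=
  forall x : X, CDFT_plus_at x.
Definition CDFT_mark (X : topologicalType) : Prop :=
  forall x : X, CDFT_mark_at x.

(* Main.v *)
Require Import Defs.
From mathcomp Require Import all_boot.
From mathcomp Require Import all_classical topology.

Local Open Scope classical_set_scope.

(** Each of the three principles, read as a property P of the target family
    B (with the source family A fixed), is monotone in B, is at least as
    strong as [Sfin A B], and is preserved by countable intersections of
    families that are closed under supersets.  These three facts yield the
    theorem ([dense_selection_tfae]):

    - a dense set clusters at every point, so monotonicity passes from density
      to clustering at x; and [Sfin] applied to the constant sequence X yields
      a dense countable union of finite sets, so the space is separable;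

    - conversely, if D is dense, a set that clusters at every point of D is
      dense, so the dense sets contain the intersection over x in D of the
      families of sets clustering at x, and this intersection is countable.

    Preservation by countable intersections ([Sfin_bigcap],
    [Sfin_plus_bigcap], [Sfin_mark_bigcap]) is where the countability of D is
    used, by staggering the starts.  Fix an injection f of the index set into
    the natural numbers.  The player following index i joins at round f i
    and treats it as round 0; at round n the indices that have joined are
    finitely many, so the union of their answers is again a legal finite
    answer.  Along any play, the part
    played from round f i on is a complete play for i, hence the total union
    contains a set that is good for i, and is itself good for i. *)

(** * Countable intersections of target families *)

Section CountableIntersection.
Context {T I : Type} {A : set (set T)} {D : set I} {B : I -> set (set T)}.
Hypothesis D_countable : countable D.
Hypothesis B_upward : forall i S S', S `<=` S' -> B i S -> B i S'.

Let joined (f : I -> nat) n := [set i | D i /\ f i <= n].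

Lemma finite_joined {f : I -> nat} n :
  {in D &, injective f} -> finite_set (joined f n).
Proof.
move=> f_inj.
have f_inj_joined : {in joined f n &, injective f}.
  move=> i j; rewrite !inE => -[Di _] [Dj _]; apply: f_inj; exact: mem_set.
rewrite -(eq_finite_set (inj_card_eq f_inj_joined)).
apply: (@sub_finite_set _ _ `I_n.+1) => [_ [i [_ i_le_n] <-] //|].
exact: finite_II.
Qed.

Lemma fin_subsets_joined {f : I -> nat} {n} {S : set T} {F : I -> set T} :
  {in D &, injective f} ->
  (forall i, D i -> f i <= n -> fin_subsets S (F i)) ->
  fin_subsets S (\bigcup_(i in joined f n) F i).
Proof.
move=> f_inj finF; split=> [x [i [Di i_le_n] Fix]|].
  exact: (finF i Di i_le_n).1.
apply: bigcup_finite; first exact: finite_joined.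
by move=> i [Di i_le_n]; exact: (finF i Di i_le_n).2.
Qed.

(** Index i sees round n + f i as its own round n, so the union of all joint
    answers contains the outcome of the complete play of i. *)
Lemma bigcap_joined {f : I -> nat} {F : I -> nat -> set T} :
  (forall i, D i -> B i (\bigcup_n F i (n + f i))) ->
  (\bigcap_(i in D) B i) (\bigcup_n \bigcup_(i in joined f n) F i n).
Proof.
move=> BF i Di; apply: B_upward (BF i Di) => x [n _ Fx].
by exists (n + f i) => //; exists i => //; split=> //; exact: leq_addl.
Qed.

Lemma Sfin_bigcap :
  (forall i, D i -> Sfin A (B i)) -> Sfin A (\bigcap_(i in D) B i).
Proof.
move=> SB a Aa; have /countable_injP[f f_inj] := D_countable.
have /choice[b b_sel] : forall i, exists b : nat -> set T, D i ->
    (forall n, fin_subsets (a (n + f i)) (b n)) /\ B i (\bigcup_n b n).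
  move=> i; case: (pselect (D i)) => [Di|]; last by exists (fun=> set0).
  by have [b bP] := SB i Di (fun n => a (n + f i)) (fun n => Aa _); exists b.
exists (fun n => \bigcup_(i in joined f n) b i (n - f i)); split=> [n|].
  apply: fin_subsets_joined => // i Di i_le_n.
  by rewrite -{1}(subnK i_le_n); exact: (b_sel i Di).1.
apply: (@bigcap_joined f (fun i n => b i (n - f i))) => i Di.
by under eq_bigcupr do rewrite addnK; exact: (b_sel i Di).2.
Qed.

Lemma Sfin_plus_bigcap :
  (forall i, D i -> Sfin_plus A (B i)) -> Sfin_plus A (\bigcap_(i in D) B i).
Proof.
move=> SB; have /countable_injP[f f_inj] := D_countable.
have /choice[sigma sigmaP] : forall i, exists sigma : seq (set T) -> set T,
    D i -> is_strategy A sigma /\ winning A (B i) sigma.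
  move=> i; case: (pselect (D i)) => [/SB[sigma ?]|]; first by exists sigma.
  by exists (fun=> set0).
(* A history of length n.+1 is answered at round n, hence the predecessor. *)
exists (fun s => \bigcup_(i in joined f (size s).-1) sigma i (drop (f i) s)).
split=> [s c As Ac|a Aa].
  rewrite size_rcons; apply: fin_subsets_joined => // i Di i_le_s.
  rewrite drop_rcons //; apply: (sigmaP i Di).1 => // d /mem_drop; exact: As.
under eq_bigcupr do rewrite size_mkseq.
apply: (@bigcap_joined f
  (fun i n => sigma i (drop (f i) (mkseq a n.+1)))) => i Di.
have drop_play n :
    drop (f i) (mkseq a (n + f i).+1) = mkseq (fun m => a (f i + m)) n.+1.
  by rewrite /mkseq -map_drop drop_iota -addSn addnK addnC iotaDl -map_comp.
under eq_bigcupr do rewrite drop_play.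
exact: (sigmaP i Di).2.
Qed.

Lemma Sfin_mark_bigcap :
  (forall i, D i -> Sfin_mark A (B i)) -> Sfin_mark A (\bigcap_(i in D) B i).
Proof.
move=> SB; have /countable_injP[f f_inj] := D_countable.
have /choice[sigma sigmaP] : forall i, exists sigma : set T -> nat -> set T,
    D i -> is_Markov_strategy A sigma /\ Markov_winning A (B i) sigma.
  move=> i; case: (pselect (D i)) => [/SB[sigma ?]|]; first by exists sigma.
  by exists (fun _ _ => set0).
exists (fun c n => \bigcup_(i in joined f n) sigma i c (n - f i)).
split=> [c n Ac|a Aa].
  by apply: fin_subsets_joined => // i Di _; exact: (sigmaP i Di).1.
apply: (@bigcap_joined f (fun i n => sigma i (a n) (n - f i))) => i Di.
under eq_bigcupr do rewrite addnK.
exact: (sigmaP i Di).2 (fun n => a (n + f i)) _.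
Qed.

End CountableIntersection.

(** * Comparison of the principles *)

Section Comparison.
Context {T : Type} {A : set (set T)}.
Implicit Types B : set (set T).

Lemma Sfin_mono B B' : B `<=` B' -> Sfin A B -> Sfin A B'.
Proof.
by move=> BB' S a /S[b [b_fin Bb]]; exists b; split=> //; exact: BB'.
Qed.

Lemma Sfin_plus_mono B B' : B `<=` B' -> Sfin_plus A B -> Sfin_plus A B'.
Proof.
move=> BB' [sigma [strat win]]; exists sigma; split=> // a Aa.
exact/BB'/win.
Qed.

Lemma Sfin_mark_mono B B' : B `<=` B' -> Sfin_mark A B -> Sfin_mark A B'.
Proof.
move=> BB' [sigma [strat win]]; exists sigma; split=> // a Aa.
exact/BB'/win.
Qed.

Lemma Sfin_plus_Sfin B : Sfin_plus A B -> Sfin A B.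
Proof.
move=> [sigma [strat win]] a Aa; exists (fun n => sigma (mkseq a n.+1)).
split=> [n|]; last exact: win.
by rewrite mkseqS; apply: strat => // _ /mapP[m _ ->].
Qed.

Lemma Sfin_mark_Sfin B : Sfin_mark A B -> Sfin A B.
Proof.
move=> [sigma [strat win]] a Aa; exists (fun n => sigma (a n) n).
by split=> [n|]; [exact: strat | exact: win].
Qed.

End Comparison.

(** * Dense sets and clustering *)

Section DenseClustering.
Context {X : topologicalType}.

Lemma dense_clustering (x : X) : dense_sets X `<=` clustering_sets x.
Proof.
move=> S dS V; rewrite nbhsE => -[O [oO Ox] OV].
have [y [Oy Sy]] := dS O (ex_intro _ x Ox) oO.
by exists y; split=> //; exact: OV.
Qed.

Lemma clustering_dense {D : set X} :
  dense D -> \bigcap_(x in D) clustering_sets x `<=` dense_sets X.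
Proof.
move=> dD S clS O O0 oO; have [x [Ox Dx]] := dD O O0 oO.
by rewrite setIC; exact: (clS x Dx O (open_nbhs_nbhs (conj oO Ox))).
Qed.

Lemma clustering_upward (x : X) (S S' : set X) :
  S `<=` S' -> clustering_sets x S -> clustering_sets x S'.
Proof. by move=> SS'; exact: (closureS SS'). Qed.

(** Playing the whole space in every round makes the union of the answers a
    countable dense set. *)
Lemma SS_separable : SS X -> separable X.
Proof.
move=> SSX; have dX : dense_sets X setT.
  by move=> O [x Ox] _; exists x.
have [b [b_fin b_dense]] := SSX (fun=> setT) (fun=> dX).
exists (\bigcup_n b n); split=> //.
by apply: bigcup_countable => // n _; exact/finite_set_countable/(b_fin n).2.
Qed.

(** The common form of the three equivalences: P stands for a selection
    principle with source family the dense sets, as a property of the target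
    family. *)
Lemma dense_selection_tfae (P : set (set X) -> Prop) :
  (forall B B', B `<=` B' -> P B -> P B') ->
  (forall B, P B -> Sfin (dense_sets X) B) ->
  (forall D : set X, countable D ->
     (forall x, D x -> P (clustering_sets x)) ->
     P (\bigcap_(x in D) clustering_sets x)) ->
  [<-> P (dense_sets X);
       separable X /\ (forall x : X, P (clustering_sets x));
       exists D : set X,
         [/\ countable D, dense D & forall x, D x -> P (clustering_sets x)]].
Proof.
move=> P_mono P_Sfin P_bigcap; tfae.
- move=> PX; split; first exact/SS_separable/P_Sfin.
  by move=> x; exact: P_mono _ _ (dense_clustering x) PX.
- by move=> [[D [cD dD]] Px]; exists D; split.
- move=> [D [cD dD PD]].
  exact: P_mono _ _ (clustering_dense dD) (P_bigcap D cD PD).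
Qed.

End DenseClustering.

Theorem theorem16 (X : topologicalType) :
  [/\ [<-> SS X;
           separable X /\ CDFT X;
           exists D : set X,
             [/\ countable D, dense D & forall x, D x -> CDFT_at x]],
      [<-> SS_plus X;
           separable X /\ CDFT_plus X;
           exists D : set X,
             [/\ countable D, dense D & forall x, D x -> CDFT_plus_at x]]
    & [<-> SS_mark X;
           separable X /\ CDFT_mark X;
           exists D : set X,
             [/\ countable D, dense D & forall x, D x -> CDFT_mark_at x]]].
Proof.
split.
- apply: (dense_selection_tfae (Sfin (dense_sets X))) => [B B'|//|D cD].
    exact: Sfin_mono.
  exact: (Sfin_bigcap cD) clustering_upward.
- apply: (dense_selection_tfae (Sfin_plus (dense_sets X))) => [B B'|B|D cD].
  + exact: Sfin_plus_mono.
  + exact: Sfin_plus_Sfin.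
  + exact: (Sfin_plus_bigcap cD) clustering_upward.
- apply: (dense_selection_tfae (Sfin_mark (dense_sets X))) => [B B'|B|D cD].
  + exact: Sfin_mark_mono.
  + exact: Sfin_mark_Sfin.
  + exact: (Sfin_mark_bigcap cD) clustering_upward.
Qed.
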